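(* Let $X$ be a first countable Hausdorff space in which all closed sets are separable, and assume that $X$ admits a non-trivial convergent sequence. Let $\mathcal{I}_\varphi$ be an analytic P-ideal on $\mathbf{N}$ which is not $F_\sigma$, and let $B\subseteq X$ be a non-empty $F_\sigma$-set. Then there exists a sequence $x$ taking values in $X$ such that $\Lambda_x(\mathcal{I}_\varphi)=B$.
   Context: $\mathbf{N}$ denotes the positive integers. An ideal $\mathcal{I}$ on $\mathbf{N}$ is a collection of subsets of $\mathbf{N}$ closed under finite unions and subsets; it is assumed to contain the family $\mathrm{Fin}$ of finite subsets of $\mathbf{N}$ and to be different from $\mathcal{P}(\mathbf{N})$. Identifying subsets of $\mathbf{N}$ with their characteristic functions, $\mathcal{P}(\mathbf{N})$ carries the Cantor-space topology of $\{0,1\}^{\mathbf{N}}$; ''$F_\sigma$'' for an ideal refers to this topology. A map $\varphi:\mathcal{P}(\mathbf{N})\to[0,\infty]$ is a lower semicontinuous submeasure if $\varphi(\emptyset)=0$; $\varphi(A)\le\varphi(B)$ whenever $A\subseteq B$; $\varphi(A\cup B)\le\varphi(A)+\varphi(B)$ for all $A,B$; and $\varphi(A)=\lim_n\varphi(A\cap\{1,\ldots,n\})$ for all $A$. Put $\|A\|_\varphi:=\lim_n\varphi(A\setminus\{1,\ldots,n\})$. By a theorem of Solecki, an ideal $\mathcal{I}$ on $\mathbf{N}$ is an analytic P-ideal if and only if $\mathcal{I}=\mathcal{I}_\varphi:=\{A\subseteq\mathbf{N}:\|A\|_\varphi=0\}$ for some lower semicontinuous submeasure $\varphi$ with $\varphi(\mathbf{N})<\infty$;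 an analytic P-ideal is always written as $\mathcal{I}_\varphi$ for such a fixed $\varphi$. $\Lambda_x(\mathcal{I})$ (the $\mathcal{I}$-limit points of $x=(x_n)$) is the set of all $\ell\in X$ such that $\lim_{k\to\infty}x_{n_k}=\ell$ for some subsequence $(x_{n_k})$ with $\{n_k:k\in\mathbf{N}\}\notin\mathcal{I}$. $X$ admits a non-trivial convergent sequence if there are $\ell\in X$ and a sequence $(\ell_n)$ in $X$ converging to $\ell$ with $\ell_n\neq\ell$ for all $n$. *)

(* Defs.v *)
From HB Require Import structures.
From mathcomp Require Import all_boot all_order all_algebra.
From mathcomp Require Import all_classical all_reals all_analysis.
From mathcomp Require Import cantor borel_hierarchy.

Set Implicit Arguments.
Unset Strict Implicit.
Unset Printing Implicit Defensive.

Import Order.TTheory GRing.Theory Num.Theory.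
Import numFieldNormedType.Exports.

Local Open Scope classical_set_scope.
Local Open Scope ring_scope.

(* The positive integers are represented by [nat], the positive integer k being
   encoded as k - 1.  The initial segment {1, ..., n} thus becomes
   [`I_n = [set k | (k < n)%N]]. *)

Record is_ideal (I : set (set nat)) : Prop := IsIdeal {
  ideal_sub : forall A B : set nat, A `<=` B -> I B -> I A;
  ideal_setU : forall A B : set nat, I A -> I B -> I (A `|` B);
  ideal_finite : forall A : set nat, finite_set A -> I A;
  ideal_proper : I <> [set: set nat] }.

(* Every point of the Cantor space {0,1}^N is the characteristic function of
   exactly one subset of N; this is the copy of [I] in the Cantor space. *)
Definition char_image (I : set (set nat)) : set cantor_space :=
  [set f | I [set n | f n = true]].

Definition ideal_Fsigma (I : set (set nat)) : Prop := Fsigma (char_image I).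

Record lsc_submeasure (R : realType) (phi : set nat -> \bar R) : Prop :=
  LscSubmeasure {
    submeasure_ge0 : forall A, (0 <= phi A)%E;
    submeasure_set0 : phi set0 = 0%E;
    submeasure_le : forall A B, A `<=` B -> (phi A <= phi B)%E;
    submeasure_setU : forall A B, (phi (A `|` B) <= phi A + phi B)%E;
    submeasure_lsc : forall A, phi (A `&` `I_n) @[n --> \oo] --> phi A }.

(* ||A||_phi; for a submeasure the sequence is nonincreasing, so that the limit
   exists and [limn] returns it. *)
Definition submeasure_norm (R : realType) (phi : set nat -> \bar R)
    (A : set nat) : \bar R :=
  limn (fun n => phi (A `\` `I_n)).

(* I_phi *)
Definition submeasure_ideal (R : realType) (phi : set nat -> \bar R) :
    set (set nat) :=
  [set A | submeasure_norm phi A = 0%E].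

(* By Solecki's theorem the analytic P-ideals are exactly the ideals I_phi with
   phi as below; an analytic P-ideal is always given through such a phi. *)
Definition analytic_P_ideal_by (R : realType) (phi : set nat -> \bar R) : Prop :=
  [/\ lsc_submeasure phi, (phi [set: nat] < +oo)%E
    & is_ideal (submeasure_ideal phi)].

(* Lambda_x(I) *)
Definition ideal_limit_points (X : topologicalType) (I : set (set nat))
    (x : nat -> X) : set X :=
  [set l | exists s : nat -> nat,
    [/\ increasing_seq s, ~ I (range s) & x (s k) @[k --> \oo] --> l]].

Definition first_countable (X : topologicalType) : Prop :=
  forall x : X, exists N : set (set X),
    [/\ countable N, N `<=` nbhs x
      & forall U, nbhs x U -> exists2 V, N V & V `<=` U].

(* [D] is dense in the subspace [A] iff [D `<=` A] and [A `<=` closure D], the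
   closure being taken in [X]. *)
Definition separable_subset (X : topologicalType) (A : set X) : Prop :=
  exists D : set X, [/\ countable D, D `<=` A & A `<=` closure D].

Definition has_nontrivial_cvg_seq (X : topologicalType) : Prop :=
  exists (l : X) (u : nat -> X),
    u n @[n --> \oo] --> l /\ forall n, u n <> l.

(* Main.v *)
(* Since I_phi is not F_sigma, there are sets of arbitrarily small submeasure
   outside I_phi, and hence a partition of N into sets A_n (the level sets of a
   function [idx]) with ||A_n|| > 0 such that the submeasure of the union of the
   A_k, k > n, tends to 0.  By lower semicontinuity A_n splits into consecutive
   blocks of submeasure at least some c_n > 0, so that any union of infinitely
   many of them is not in I_phi.  Write B as the union of nonempty closed sets
   F_n, and let x be constant on each block of A_n, its values on the successive
   blocks running through a dense sequence of F_n that repeats every value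
   infinitely often.  By first countability every point of F_n is the limit of x
   along infinitely many blocks of A_n.  Conversely, a set outside I_phi is, up to
   a set of smaller submeasure, contained in finitely many A_n, where x takes its
   values in the closed set F_0 u ... u F_n. *)
Require Import Defs.
From HB Require Import structures.
From mathcomp Require Import all_boot all_order all_algebra.
From mathcomp Require Import all_classical all_reals all_analysis.
From mathcomp Require Import cantor borel_hierarchy.
From mathcomp Require Import lra zify.

Set Implicit Arguments.
Unset Strict Implicit.
Unset Printing Implicit Defensive.

Import Order.TTheory GRing.Theory Num.Theory.
Import numFieldNormedType.Exports.

Local Open Scope classical_set_scope.
Local Open Scope ring_scope.

(** * Submeasures with finite values and their tails *)

Record real_submeasure {R : realType} (psi : set nat -> R) : Prop :=
  RealSubmeasure {
    real_submeasure_set0 : psi set0 = 0;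
    real_submeasure_le : forall A B, A `<=` B -> psi A <= psi B;
    real_submeasure_setU : forall A B, psi (A `|` B) <= psi A + psi B;
    real_submeasure_lsc :
      forall A c, (forall n, psi (A `&` `I_n) <= c) -> psi A <= c }.

(** For monotone [psi] this is $\|A\|_\psi \ge c$, free of limits. *)
Definition tail_ge {R : realType} (psi : set nat -> R) (c : R) (A : set nat) :=
  forall n, c <= psi (A `\` `I_n).

Lemma submeasure_fin_num (R : realType) (phi : set nat -> \bar R) :
  lsc_submeasure phi -> (phi setT < +oo)%E -> forall A, phi A \is a fin_num.
Proof.
move=> phiP phiT A; rewrite ge0_fin_numE; last exact: (submeasure_ge0 phiP).
exact: le_lt_trans (submeasure_le phiP (@subsetT _ A)) phiT.
Qed.

Lemma fine_submeasure (R : realType) (phi : set nat -> \bar R) :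
  lsc_submeasure phi -> (phi setT < +oo)%E -> real_submeasure (fine \o phi).
Proof.
move=> phiP phiT.
have fin := submeasure_fin_num phiP phiT.
split=> /=.
- by rewrite (submeasure_set0 phiP).
- by move=> A B AB; rewrite fine_le ?fin//; exact: (submeasure_le phiP AB).
- move=> A B; rewrite -fineD// fine_le ?fin_numD ?fin//.
  exact: (submeasure_setU phiP A B).
- move=> A c ub; rewrite -lee_fin fineK//.
  have lim := submeasure_lsc phiP (A := A); rewrite -(cvg_lim _ lim)//.
  apply: lime_le; first by apply/cvg_ex; exists (phi A).
  by apply: nearW => n; rewrite -(fineK (fin _)) lee_fin.
Qed.

(** The tails are nonincreasing, so the norm is their infimum; a nonzero infimum itself serves as
    [c]. *)
Lemma submeasure_idealPn (R : realType) (phi : set nat -> \bar R) (A : set nat) :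
  lsc_submeasure phi -> (phi setT < +oo)%E ->
  ~ submeasure_ideal phi A <-> exists2 c, 0 < c & tail_ge (fine \o phi) c A.
Proof.
move=> phiP phiT.
have fin := submeasure_fin_num phiP phiT.
have lim : phi (A `\` `I_n) @[n --> \oo] -->
    ereal_inf (range (fun n => phi (A `\` `I_n))).
  apply: ereal_nonincreasing_cvgn => m n mn; apply: (submeasure_le phiP).
  by move=> k [Ak /= kn]; split=> //= km; apply: kn; exact: leq_trans km mn.
rewrite /submeasure_ideal /submeasure_norm /= (cvg_lim _ lim)//.
set i := ereal_inf _.
have i0 : (0 <= i)%E.
  by apply: le_ereal_inf_tmp => _ [n _ <-]; exact: (submeasure_ge0 phiP _).
have ile n : (i <= phi (A `\` `I_n))%E by apply: ereal_inf_lbound; exists n.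
have ifin : i \is a fin_num.
  by rewrite ge0_fin_numE//; apply: le_lt_trans (ile 0%N) _; rewrite ltey_eq fin.
split=> [/eqP iN0|[c c0 cA] iE].
  exists (fine i); first by rewrite fine_gt0// lt_neqAle eq_sym iN0 i0 ltey_eq ifin.
  by move=> n /=; rewrite fine_le ?fin.
suff : (c%:E <= i)%E by rewrite iE lee_fin leNgt c0.
by apply: le_ereal_inf_tmp => _ [n _ <-]; rewrite -(fineK (fin _)) lee_fin cA.
Qed.

(** * The Cantor space and small sets outside the ideal *)

(** Agreement with a point on finitely many coordinates is a neighbourhood of it in the product
    topology. *)
Lemma closed_finitely_determined (P : set (set nat)) (m : nat) :
  (forall A B, A `&` `I_m = B `&` `I_m -> P A -> P B) -> closed (char_image P).
Proof.
move=> Pm; rewrite -[char_image P]setCK; apply: open_closedC.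
rewrite openE => f nPf; rewrite /interior.
have : \forall g \near (f : cantor_space), forall i, (i < m)%N -> g i = f i.
  elim: m {Pm} => [|m IH]; first by near=> g.
  have fm : \forall g \near (f : cantor_space), g m = f m.
    have := @proj_continuous nat (fun=> bool) m f.
    by move=> /(_ [set f m]); apply; exact: discrete_set1.
  near=> g => i; rewrite ltnS leq_eqVlt => /orP[/eqP ->|im].
    by near: g.
  by move: i im; near: g.
apply: filterS => g gf /= Pg; apply: nPf; apply: Pm Pg.
by apply/seteqP; split=> i /= [gi im]; split=> //; rewrite ?gf// -gf.
Unshelve. all: by end_near. Qed.

(* If [fine (phi A) < d] implied membership, the ideal would be the union over
   [n] of the closed sets [{A | phi (A \ `I_n) <= d / 2}]. *)
Lemma not_Fsigma_small (R : realType) (phi : set nat -> \bar R) :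
  analytic_P_ideal_by phi -> ~ ideal_Fsigma (submeasure_ideal phi) ->
  forall d : R, 0 < d ->
    exists A, ~ submeasure_ideal phi A /\ fine (phi A) < d.
Proof.
move=> [phiP phiT idP] nF d d0; apply: contrapT => noA; apply: nF.
have small A : fine (phi A) < d -> submeasure_ideal phi A.
  by move=> Ad; apply: contrapT => nA; apply: noA; exists A.
have psiP := fine_submeasure phiP phiT; have [_ mono _ lsc] := psiP.
(* By lower semicontinuity a bound on a tail amounts to bounds on its finite pieces, which are
   closed conditions. *)
exists (fun n => \bigcap_m
   char_image [set A | fine (phi ((A `\` `I_n) `&` `I_m)) <= d / 2]).
  move=> n; apply: closed_bigI => m _.
  apply: (@closed_finitely_determined _ m) => A B AB /=.
  by rewrite !(setIC _ `I_m) !setIDA !(setIC `I_m) AB.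
apply/seteqP; split=> f /= If.
  have : ~ tail_ge (fine \o phi) (d / 2) [set n | f n = true].
    move=> tl; have /submeasure_idealPn : exists2 c, 0 < c &
      tail_ge (fine \o phi) c [set n | f n = true] by exists (d / 2) => //; lra.
    by apply.
  move=> /existsNP[n /negP]; rewrite -ltNge => /ltW le.
  by exists n => // m _ /=; apply: le_trans le; exact: mono.
case: If => n _ If.
have le : fine (phi ([set n | f n = true] `\` `I_n)) <= d / 2.
  by apply: lsc => m; exact: If.
apply: (ideal_sub idP) (ideal_setU idP (small _ _)
   (ideal_finite idP (finite_II n))); last by apply: le_lt_trans le _; lra.
by move=> k fk; have [kn|kn] := pselect (`I_n k); [right|left].
Qed.

(** * Partition into sets of positive tail, and their blocks *)

(** Deleting an initial segment keeps the tail bound; [k <= m] later puts each point in only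
    finitely many sets. *)
Lemma not_Fsigma_small_tail (R : realType) (phi : set nat -> \bar R) :
  analytic_P_ideal_by phi -> ~ ideal_Fsigma (submeasure_ideal phi) ->
  forall (d : R) k, 0 < d -> exists (A : set nat) c,
    [/\ 0 < c, fine (phi A) < d, forall m, A m -> (k <= m)%N
      & tail_ge (fine \o phi) c A].
Proof.
move=> phiI nF d k d0; have [A [nA Ad]] := not_Fsigma_small phiI nF d0.
case: phiI => phiP phiT _; have [_ mono _ _] := fine_submeasure phiP phiT.
have /(submeasure_idealPn _ phiP phiT)[c c0 cA] := nA.
exists (A `\` `I_k), c; split=> //.
- by apply: le_lt_trans Ad; apply: mono.
- by move=> m [_ /negP]; rewrite -leqNgt.
- move=> n; apply: le_trans (cA (maxn k n)) _; apply: mono.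
  move=> m [Am /= /negP]; rewrite -leqNgt geq_max => /andP[km nm].
  by split; [split=> //|] => /=; lia.
Qed.

(* Choose [A_n] of positive tail with [psi A_(n+1)] much smaller than the tail
   of [A_n]; then [A_n] minus all later sets still has positive tail.  The
   points outside every [A_n] get index 0. *)
Lemma partition_positive_tails {R : realType} {psi : set nat -> R} :
  real_submeasure psi ->
  (forall (d : R) k, 0 < d -> exists (A : set nat) c,
    [/\ 0 < c, psi A < d, forall m, A m -> (k <= m)%N & tail_ge psi c A]) ->
  exists idx : nat -> nat,
    (forall n, exists2 c, 0 < c & tail_ge psi c [set m | idx m = n]) /\
    (forall d, 0 < d -> exists n, psi [set m | (n < idx m)%N] < d).
Proof.
move=> [psi0 mono sub lsc] small.
have /choice[g gP] (p : R * nat) : exists q : set nat * R, 0 < p.1 ->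
    [/\ 0 < q.2, psi q.1 < p.1, forall m, q.1 m -> (p.2 <= m)%N
      & tail_ge psi q.2 q.1].
  case: p => d k /=.
  have [d0|d0] := pselect (0 < d); last by exists (set0, 0).
  by have [A [c ?]] := small d k d0; exists (A, c).
(* Stage [n.+1] gets the budget [c n / 4], called [e n.+1] below. *)
pose s := fix s n := match n with
  | 0%N => g (1, 0%N) | n'.+1 => g ((s n').2 / 4, n'.+1) end.
pose A n := (s n).1; pose c n := (s n).2.
pose e n := if n is n'.+1 then c n' / 4 else 1.
have sP n : 0 < e n /\ [/\ 0 < c n, psi (A n) < e n,
    forall m, A n m -> (n <= m)%N & tail_ge psi (c n) (A n)].
  elim: n => [|n [_ [cn _ _ _]]]; first by split=> //; exact: gP.
  have en : 0 < e n.+1 by rewrite /e; lra.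
  by split=> //; exact: (gP (e n.+1, n.+1)).
have ce n : c n < e n.
  have [_ [_ An _ /(_ 0%N) cA]] := sP n.
  by apply: le_lt_trans (le_trans cA _) An; apply: mono.
(* Budgets drop by a factor of at least 4, so finite unions from stage [n] on stay below [2 * e n];
   [Ule] reaches the infinite union by lower semicontinuity. *)
pose T n j := [set m | exists2 k, (n <= k < n + j)%N & A k m].
have Tle j n : psi (T n j) <= 2 * e n.
  elim: j n => [|j IH] n; have [en [_ An _ _]] := sP n.
    suff -> : T n 0%N = set0 by rewrite psi0; lra.
    by rewrite -subset0 => m [k]; lia.
  apply: (@le_trans _ _ (psi (A n `|` T n.+1 j))).
    apply: mono => m [k kn Akm]; have [nk|nk] := eqVneq n k.
      by left; rewrite nk.
    by right; exists k => //; lia.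
  have := sub (A n) (T n.+1 j); have := IH n.+1; have := ce n.
  by rewrite [e n.+1]/=; lra.
(* Searching up to [m] suffices, since [A n] starts at [n] or later. *)
pose idx m := \max_(n < m.+1 | `[< A n m >]) (n : nat).
have idx_gt n m : (n < idx m)%N -> exists2 k, (n < k <= m)%N & A k m.
  move=> nm; apply: contrapT => noK; move: nm; apply/negP; rewrite -leqNgt.
  apply/bigmax_leqP => k /asboolP Akm; rewrite leqNgt; apply/negP => nk.
  by apply: noK; exists k => //; rewrite nk -ltnS ltn_ord.
have idx_ge n m : A n m -> (n <= idx m)%N.
  move=> Anm; have [_ [_ _ /(_ m Anm) nm _]] := sP n.
  have nm' : (n < m.+1)%N by [].
  by apply: (leq_bigmax_cond (Ordinal nm')); apply/asboolP.
have Ule n : psi [set m | (n < idx m)%N] <= c n / 2.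
  apply: lsc => p; apply: (@le_trans _ _ (psi (T n.+1 p))).
    apply: mono => m [/= /idx_gt[k nk Akm] mp]; exists k => //; lia.
  by apply: le_trans (Tle _ _) _; rewrite [e n.+1]/=; lra.
exists idx; split=> [n|d d0].
  (* Removing the later sets costs at most half of the tail bound [c n]. *)
  have [_ [cn _ _ tl]] := sP n; exists (c n / 2); first lra.
  move=> p; have := tl p; have := Ule n.
  have : psi (A n `\` `I_p) <= psi (([set m | idx m = n] `\` `I_p) `|`
      [set m | (n < idx m)%N]).
    apply: mono => m [/= /idx_ge nm mp]; move: nm; rewrite leq_eqVlt.
    by move=> /orP[/eqP ?|?]; [left|right].
  by have := sub ([set m | idx m = n] `\` `I_p) [set m | (n < idx m)%N]; lra.
(* Decay by a factor of 4 suffices, as [n.+2 <= 4 * n.+1]. *)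
have cn1 n : c n * n.+1%:R <= 1.
  elim: n => [|n IH]; first by have := ce 0%N; rewrite mulr1 /e; lra.
  have := ce n.+1; rewrite [e n.+1]/= => cn.
  have [_ [cn0 _ _ _]] := sP n.
  apply: le_trans IH; apply: (@le_trans _ _ (c n / 4 * n.+2%:R)).
    by rewrite ler_wpM2r// ltW.
  rewrite -mulrA ler_wpM2l ?ltW//.
  by rewrite -[n.+2]addn1 natrD; have : 1 <= n.+1%:R :> R;
    [rewrite ler1n|lra].
have := archi_boundP (ltW (divr_gt0 ltr01 d0)); set n := Num.bound _.
rewrite ltr_pdivrMr// => nd; exists n.
have [_ [cn0 _ _ _]] := sP n.
apply: le_lt_trans (Ule n) _; apply: (@lt_trans _ _ (c n)); first lra.
rewrite -(ltr_pM2r (x := n.+1%:R))//; apply: le_lt_trans (cn1 n) _.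
by apply: lt_le_trans nd _; rewrite mulrC ler_wpM2l ?(ltW d0)// ler_nat.
Qed.

(** Cut greedily: each tail has submeasure at least [c], so by lower semicontinuity some finite
    piece exceeds [c / 2]; [h] numbers the intervals between cuts. *)
Lemma positive_blocks {R : realType} {psi : set nat -> R} {c : R} {A : set nat} :
  real_submeasure psi -> 0 < c -> tail_ge psi c A ->
  exists h : nat -> nat, {homo h : m n / (m <= n)%N} /\
    forall k, c / 2 <= psi (A `&` [set m | h m = k]).
Proof.
move=> [psi0 mono sub lsc] c0 cA.
have /choice[r rP] q : exists r, c / 2 < psi ((A `\` `I_q) `&` `I_r).
  apply: contrapT => noR; have := cA q.
  suff : psi (A `\` `I_q) <= c / 2 by lra.
  by apply: lsc => n; rewrite leNgt; apply/negP => qn; apply: noR; exists n.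
have r_gt q : (q < r q)%N.
  rewrite ltnNge; apply/negP => rq; have := rP q.
  suff -> : (A `\` `I_q) `&` `I_(r q) = set0 by rewrite psi0; lra.
  by rewrite -subset0 => m [[_ /= mq] mr]; apply: mq; exact: leq_trans mr rq.
pose p k := iter k r 0%N.
have p_le : {homo p : m n / (m <= n)%N}.
  by apply: homo_leq => [//|? ? ?|k]; [exact: leq_trans|exact: ltnW (r_gt _)].
have /choice[h hP] m : exists k, (p k <= m < p k.+1)%N.
  elim: m => [|m [k /andP[km mk]]].
    by exists 0%N; rewrite /=; exact: r_gt.
  have [mk'|mk'] := ltnP m.+1 (p k.+1); first by exists k; rewrite mk' leqW.
  by exists k.+1; rewrite mk' (leq_ltn_trans mk)// /p iterS r_gt.
exists h; split=> [m n mn|k].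
  rewrite leqNgt; apply/negP => /p_le nm.
  have /andP[hm _] := hP m; have /andP[_ hn] := hP n; lia.
apply: le_trans (ltW (rP (p k))) _; apply: mono => m [[Am /= /negP]].
rewrite -leqNgt => pm mp; split=> //=; have /andP[h1 h2] := hP m.
apply/eqP; rewrite eqn_leq; apply/andP; split; rewrite leqNgt; apply/negP.
  by move=> /p_le; rewrite {1}/p iterS -/(p k); lia.
by move=> /p_le; lia.
Qed.

(** * Dense sequences, subsequences and enumerations *)

Lemma countable_range (T : Type) (A : set T) :
  countable A -> A !=set0 -> exists e : nat -> T, range e = A.
Proof.
move=> /countable_injP[f finj] [a Aa].
have /choice[e eP] (n : nat) : exists t, A t /\ forall b, A b -> f b = n -> t = b.
  have [[b Ab fb]|noB] := pselect (exists2 b, A b & f b = n).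
    by exists b; split=> // b' Ab' fb'; apply: finj; rewrite ?inE// fb'.
  by exists a; split=> // b Ab fb; exfalso; apply: noB; exists b.
exists e; apply/seteqP; split=> [_ [n _ <-]|b Ab]; first by have [] := eP n.
by exists (f b) => //; apply: (eP (f b)).2.
Qed.

(** Infinite repetition makes even isolated points of [F] cluster points. *)
Lemma dense_cluster_seq (X : topologicalType) (F : set X) :
  separable_subset F -> F !=set0 -> exists d : nat -> X, (forall k, F (d k)) /\
    forall l, F l -> forall U, nbhs l U -> forall j, exists2 k, (j <= k)%N & U (d k).
Proof.
move=> [D [cD DF FD]] [b Fb].
have [b' [Db' _]] := FD b Fb setT filterT.
have [e eD] : exists e : nat -> X, range e = D by apply: countable_range cD _; exists b'.
(* every [a] equals [logn 2 k] for infinitely many [k] *)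
exists (fun k => e (logn 2 k)); split=> [k|l Fl U Ul j].
  by apply: DF; rewrite -eD; exists (logn 2 k).
have [y [Dy Uy]] := FD l Fl U Ul.
move: Dy; rewrite -eD => -[a _ ey]; exists (2 ^ a * j.*2.+1)%N.
  apply: leq_trans (leq_pmull _ _); last by rewrite expn_gt0.
  by rewrite -addnn; lia.
rewrite lognM ?expn_gt0// pfactorK// logn_coprime ?addn0 ?ey//.
by rewrite coprime2n /= odd_double.
Qed.

Lemma first_countable_subseq (X : topologicalType) (d : nat -> X) (l : X) :
  first_countable X ->
  (forall U, nbhs l U -> forall j, exists2 k, (j <= k)%N & U (d k)) ->
  exists k : nat -> nat, (forall i, (k i < k i.+1)%N) /\ d (k i) @[i --> \oo] --> l.
Proof.
move=> /(_ l)[N [cN Nl base]] clu.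
have [V VN] : exists V : nat -> set X, range V = N.
  by apply: countable_range cN _; have [B NB _] := base setT filterT; exists B.
(* Finite intersections turn the base into a decreasing one. *)
pose W i : set X := [set y | forall j, (j <= i)%N -> V j y].
have Wl i : nbhs l (W i).
  have Vl j : nbhs l (V j) by apply: Nl; rewrite -VN; exists j.
  elim: i => [|i IH]; first by apply: filterS (Vl 0%N) => y Vy [].
  apply: filterS (filterI IH (Vl i.+1)) => y [Wy Vy] j.
  by rewrite leq_eqVlt => /orP[/eqP ->//|]; rewrite ltnS; exact: Wy.
have /choice[g gP] (p : nat * nat) : exists q, (p.2 <= q)%N /\ W p.1 (d q).
  case: p => i j.
  by have [q] := clu _ (Wl i) j; exists q.
pose k := fix k i := if i is i'.+1 then g (i, (k i').+1) else g (0%N, 0%N).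
exists k; split=> [i|]; first by have [] := gP (i.+1, (k i).+1).
have Wk i : W i (d (k i)).
  by case: i => [|i]; [have [] := gP (0%N, 0%N)|have [] := gP (i.+1, (k i).+1)].
move=> U /base[B]; rewrite -VN => -[j _ <-] VU.
by exists j => // i /= ji; apply: VU; exact: Wk.
Qed.

Lemma infinite_nat_enum (S : set nat) :
  (forall q, exists2 m, (q <= m)%N & S m) ->
  exists2 s : nat -> nat, increasing_seq s & range s = S.
Proof.
move=> Sinf.
have /choice[r rP] q : exists n,
    [/\ (q <= n)%N, S n & forall m, (q <= m)%N -> S m -> (n <= m)%N].
  have ex : exists m, (q <= m)%N && `[< S m >].
    by have [m qm Sm] := Sinf q; exists m; rewrite qm; apply/asboolP.
  case: (ex_minnP ex) => m /andP[qm /asboolP Sm] mmin; exists m; split=> // n qn Sn.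
  by apply: mmin; rewrite qn; apply/asboolP.
pose s := fix s i := if i is i'.+1 then r (s i').+1 else r 0%N.
have s_lt i : (s i < s i.+1)%N by have [] := rP (s i).+1.
have s_ge i : (i <= s i)%N.
  by elim: i => // i IH; exact: leq_ltn_trans IH (s_lt i).
exists s; first exact/increasing_seqP.
apply/seteqP; split=> [_ [[|i] _ <-]|m Sm].
- by have [] := rP 0%N.
- by have [] := rP (s i).+1.
(* The first [s i] not below [m] equals [m], by the minimality in [rP]. *)
- have ex : exists i, (m <= s i)%N by exists m.
  case: (ex_minnP ex) => i mi imin; exists i => //; apply/eqP.
  rewrite eqn_leq mi andbT; case: i mi imin => [|i] mi imin.
    by have [_ _] := rP 0%N; apply.
  have [_ _] := rP (s i).+1; apply => //; rewrite ltnNge; apply/negP => /imin.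
  by rewrite ltnn.
Qed.

(** Empty pieces are replaced by a nonempty one, as each piece must later supply values of the
    sequence. *)
Lemma Fsigma_nonempty (X : topologicalType) (B : set X) :
  B !=set0 -> Fsigma B -> exists F : nat -> set X,
    [/\ forall n, closed (F n), forall n, F n !=set0 & \bigcup_n F n = B].
Proof.
move=> [b Bb] [F Fcl BF]; move: Bb; rewrite {1}BF => -[n0 _ Fb].
have /choice[G GP] n : exists C : set X,
    [/\ closed C, C !=set0, F n `<=` C & C `<=` B].
  have FB k : F k `<=` B by rewrite BF; exact: bigcup_sup.
  have [Fn|/nonemptyPn Fn] := pselect (F n !=set0); first by exists (F n); split.
  by exists (F n0); split=> //; [exists b|rewrite Fn].
exists G; split=> [n|n|]; [by have [] := GP n|by have [] := GP n|].
apply/seteqP; split=> [y [n _]|]; first by have [_ _ _] := GP n; apply.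
by rewrite {1}BF => y [n _ Fy]; exists n => //; have [_ _ + _] := GP n; apply.
Qed.

(** * The sequence and its limit points *)

Theorem theorem2p6 (R : realType) (X : topologicalType)
    (X_first_countable : first_countable X)
    (X_hausdorff : hausdorff_space X)
    (X_closed_separable : forall C : set X, closed C -> separable_subset C)
    (X_nontrivial : has_nontrivial_cvg_seq X)
    (phi : set nat -> \bar R)
    (phi_ideal : analytic_P_ideal_by phi)
    (phi_not_Fsigma : ~ ideal_Fsigma (submeasure_ideal phi))
    (B : set X) (B_neq0 : B !=set0) (B_Fsigma : Fsigma B) :
  exists x : nat -> X, ideal_limit_points (submeasure_ideal phi) x = B.
Proof.
have [phiP phiT idP] := phi_ideal.
have psiP := fine_submeasure phiP phiT; have [psi0 mono sub _] := psiP.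
have [idx [idx_tail idx_small]] := partition_positive_tails psiP
  (not_Fsigma_small_tail phi_ideal phi_not_Fsigma).
have [F [F_closed F_neq0 FB]] := Fsigma_nonempty B_neq0 B_Fsigma.
have /choice[h hP] n : exists hn : nat -> nat,
    {homo hn : m n / (m <= n)%N} /\ exists2 c, 0 < c & forall k,
    c <= fine (phi ([set m | idx m = n] `&` [set m | hn m = k])).
  have [c c0 tl] := idx_tail n; have [hn [hle hc]] := positive_blocks psiP c0 tl.
  by exists hn; split=> //; exists (c / 2); first lra.
have /choice[d dP] n : exists dn : nat -> X, (forall k, F n (dn k)) /\
    forall l, F n l -> forall U, nbhs l U ->
    forall j, exists2 k, (j <= k)%N & U (dn k).
  exact: dense_cluster_seq (X_closed_separable _ (F_closed n)) (F_neq0 n).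
exists (fun m => d (idx m) (h (idx m) m)); apply/seteqP; split=> l.
  case=> s [s_incr /(submeasure_idealPn _ phiP phiT)[c c0 tl] s_l].
  (* Points of index above [n] have submeasure below [c]. A neighbourhood of [l] avoiding [F 0],
     ..., [F n] forces a tail of [range s] into them, against [tl]. *)
  apply: contrapT => nBl; have [n nc] := idx_small c c0.
  have : nbhs l [set y | forall j, (j <= n)%N -> ~ F j y].
    have nF j : nbhs l (~` F j).
      apply: open_nbhs_nbhs; split; first exact: closed_openC.
      by move=> Fl; apply: nBl; rewrite -FB; exists j.
    elim: n {nc} => [|n IH]; first by apply: filterS (nF 0%N) => y Fy [].
    apply: filterS (filterI IH (nF n.+1)) => y [Fy Fny] j.
    by rewrite leq_eqVlt => /orP[/eqP ->//|]; rewrite ltnS; exact: Fy.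
  move=> /s_l[q _ sq]; have := tl (s q).
  suff : fine (phi (range s `\` `I_(s q))) <= fine (phi [set m | (n < idx m)%N]).
    by move: nc => /=; lra.
  apply: mono => m [[k _ <-] /= /negP]; rewrite -leqNgt => sqk.
  rewrite ltnNge; apply/negP => kn.
  have qk : (q <= k)%N by rewrite -s_incr.
  by apply: (sq k qk _ kn); have [] := dP (idx (s k)).
rewrite -FB => -[n _ Fl]; have [h_le [c c0 hc]] := hP n.
have [_ /(_ l Fl)] := dP n.
move=> /(first_countable_subseq X_first_countable)[k [k_lt k_l]].
have k_incr : increasing_seq k by apply/increasing_seqP.
(* A block of positive submeasure is nonempty. *)
have h_onto i : exists2 m, idx m = n & h n m = i.
  apply: contrapT => no; have := hc i; move: psi0 => /= psi0.
  suff -> : [set m | idx m = n] `&` [set m | h n m = i] = set0.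
    rewrite psi0; lra.
  by rewrite -subset0 => m [? ?]; apply: no; exists m.
(* Blocks of index [n] numbered along [k]: the values there converge to [l], and every tail contains
   a whole block. *)
pose S := [set m | idx m = n /\ exists i, h n m = k i].
have block_sub q : exists i, [set m | idx m = n] `&` [set m | h n m = k i] `<=`
    S `\` `I_q.
  have k_ge i : (i <= k i)%N.
    by elim: i => // i IH; exact: leq_ltn_trans IH (k_lt i).
  (* Since [i <= k i] and [h n] is monotone, block [k (h n q).+1] lies beyond [q]. *)
  exists (h n q).+1 => m [/= mn hm]; split; first by split=> //; exists (h n q).+1.
  move=> /= /ltnW /h_le; have := k_ge (h n q).+1; lia.
have [s s_incr sS] : exists2 s : nat -> nat, increasing_seq s & range s = S.
  apply: infinite_nat_enum => q; have [i sub_i] := block_sub q.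
  have [m mn hm] := h_onto (k i); have [Sm /= /negP] := sub_i m (conj mn hm).
  by rewrite -leqNgt; exists m.
exists s; split=> //.
  apply/(submeasure_idealPn _ phiP phiT); exists c => // q; rewrite sS.
  have [i sub_i] := block_sub q; apply: le_trans (hc (k i)) _; exact: mono.
have s_ge i : (i <= s i)%N.
  elim: i => // i IH; apply: leq_ltn_trans IH _.
  by have /increasing_seqP := s_incr; apply.
(* From a point [m] of block [k i0] on, elements of [S] lie in blocks [k i] with [k i0 <= k i],
   hence [i0 <= i]. *)
move=> U /k_l[i0 _ kU]; have [m mn hm] := h_onto (k i0).
exists m => // j /= mj; have : S (s j) by rewrite -sS; exists j.
move=> [-> [i hi]]; rewrite hi; apply: (kU i); rewrite /= -k_incr leEnat.
by rewrite -hi -hm; apply: h_le; exact: leq_trans mj (s_ge j).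
Qed.
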